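(* Let $\Lambda$ be a $k$-graph and $w\in\Lambda^0$ such that $(\Lambda,w)$ satisfies $H_{CR}$. Then $w$ is fully reducible with color set $E$, and $w\Lambda^E=\{f_b:b\in E\}$ is a stationary set (with color set $E$). Consequently $(\Lambda,w)$ satisfies both $H_R$ (with color set $B=E$) and $H_{CR}$, so $\Lambda_R$ and $\Lambda_{CR}$ exist, and $\Lambda_{CR}\cong\Lambda_R$ as $k$-graphs.
   Context: **$k$-graphs.** $0\in\mathbb N$; $E=\{e_1,\dots,e_k\}$ is the standard basis of $\mathbb N^k$, whose elements are called colors. A $k$-graph is a countable category $\Lambda$ with a functor $d:\Lambda\to\mathbb N^k$ such that for every $\lambda\in\Lambda$ and $m,n\in\mathbb N^k$ with $d(\lambda)=m+n$ there are unique $\mu,\nu\in\Lambda$ with $d(\mu)=m$, $d(\nu)=n$, $\lambda=\mu\nu$. Composition is from right to left. For $A\subseteq\mathbb N^k$, $\Lambda^A=\{\lambda:d(\lambda)\in A\}$, $\Lambda^n=\Lambda^{\{n\}}$; $\Lambda^0$ is the set of vertices (identified with objects) and $\Lambda^E$ the set of edges; $s,r$ are source and range; $w\Lambda^A=\{\lambda\in\Lambda^A:r(\lambda)=w\}$, $\Lambda^Av=\{\lambda\in\Lambda^A:s(\lambda)=v\}$, $w\Lambda^Av=w\Lambda^A\cap\Lambda^Av$. The 1-skeleton $G(\Lambda)$ is the directed graph $(\Lambda^0,\Lambda^E,s,r)$ with edges colored by $d$; $G(\Lambda)^*$ is its path category; for paths, $\mu\sim\nu$ means that $\mu$ and $\nu$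 have the same composite in $\Lambda$. An isomorphism $\cong$ of $k$-graphs is a bijective degree-preserving functor. **Reducibility.** A vertex $w$ is reducible with color set $\emptyset\ne B\subseteq E$ if there is $v\in\Lambda^0$ such that: every $\mu\in w\Lambda^Ev$ has $d(\mu)\in B$; for all $b\in B$, $w\Lambda^b=\{f_b\}$ is a singleton; $w\notin r(\Lambda^Bw)$; and $s(w\Lambda^B)=\{v\}$. Put $\mathcal E=E\setminus B$. The neighborhood $U_w^{\mathcal E}$ is the (undirected) connected component containing $w$ of the subgraph of $G(\Lambda)$ with vertex set $\Lambda^0$ and edge set $\Lambda^{\mathcal E}$; $(U_w^{\mathcal E})^0$ and $(U_w^{\mathcal E})^E$ are its vertices and edges, and for a vertex $x$, $x\in U_w^{\mathcal E}$ means $x\in(U_w^{\mathcal E})^0$. $w$ is fully reducible with color set $B$ if each $x\in(U_w^{\mathcal E})^0$ is reducible with color set $B$ and $\big(\bigcup_{x\in (U_w^{\mathcal E})^0}\Lambda^Bx\big)\cap\big(\bigcup_{x\in (U_w^{\mathcal E})^0}x\Lambda^B\big)=\emptyset$. For $x\in(U_w^{\mathcal E})^0$ and $b\in B$, $f_{b,x}$ denotes the unique edge of color $b$ with range $x$. **Stationary.** A set $\mathcal F\subseteq\Lambda^E$ is stationary in color set $B$ if for all $f_1,f_2\in\mathcal F$: $s(f_1)=s(f_2)$ and $r(f_1)=r(f_2)$; if $\lambda\in\Lambda^Br(f_1)$ and $\lambda f_1\sim\nu\mu$ (with $\nu,\mu$ edges), then $\mu\in\mathcal F$; if $\lambda\in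 s(f_1)\Lambda^B$ and $f_1\lambda\sim\nu\mu$ (with $\nu,\mu$ edges), then $\nu\in\mathcal F$. **Hypotheses $H_R$ (with color set $B$).** $w$ is fully reducible with color set $B$, and for every $x\in(U_w^{\mathcal E})^0$ the set $x\Lambda^B$ is stationary with color set $B$. **Reduction (R).** For $(\Lambda,w)$ satisfying $H_R$, define a colored directed graph $G(\Lambda_R)$ by $\Lambda_R^0=\Lambda^0\setminus(U_w^{\mathcal E})^0$, $\Lambda_R^E=\Lambda^E\setminus\big((U_w^{\mathcal E})^E\cup\bigcup_{x\in(U_w^{\mathcal E})^0}x\Lambda^B\big)$, with edges keeping their colors, $r_R(\mu)=r(\mu)$, and $s_R(\mu)=s(f_{b,s(\mu)})$ if $s(\mu)\in U_w^{\mathcal E}$, $s_R(\mu)=s(\mu)$ otherwise. Let $\iota:\Lambda_R^E\to\Lambda^E$ be the inclusion. Fix $b\in B$. Define $\operatorname{par}_R$ on edges by $\operatorname{par}_R(\mu)=\iota(\mu)f_{b,s(\iota(\mu))}$ if $s(\iota(\mu))\in(U_w^{\mathcal E})^0$ and $\operatorname{par}_R(\mu)=\iota(\mu)$ otherwise, by the identity on vertices, and extend multiplicatively to paths. Define $\sim_R$ on $G(\Lambda_R)^*$: on vertices and edges it is equality; for paths $\mu,\nu$ of length at least 2, $\mu\sim_R\nu$ iff $\operatorname{par}_R(\mu)=\operatorname{par}_R(\nu)$ in $\Lambda$. Then $\Lambda_R=G(\Lambda_R)^*/\sim_R$ is a $k$-graph. **Complete edge.** A set $G\subseteq\Lambda^E$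 is a complete edge if: (1) $G$ contains precisely one edge of each color; (2) $s(g_1)=s(g_2)$ and $r(g_1)=r(g_2)$ for all $g_1,g_2\in G$; (3) if $g_1\in G$ and $\mu,\eta,g\in\Lambda^E$ satisfy $\mu g_1\sim g\eta$ or $\mu g_1\sim\eta g$, then $g\in G$. **Complete edge reduction (CR).** $H_{CR}$: $\Lambda^Ew$ and $w\Lambda^E$ are complete edges and $w\ne x$, where $x:=r(\Lambda^Ew)$ is the common range. Define the colored graph with $\Lambda_{CR}^0=\Lambda^0\setminus\{w\}$, $\Lambda_{CR}^E=\Lambda^E\setminus\Lambda^Ew$ (edges keep their colors), $s_{CR}(e)=s(e)$, and $r_{CR}(e)=r(e)$ if $r(e)\ne w$, $r_{CR}(e)=x$ if $r(e)=w$. With $\iota$ the inclusion and a fixed $g\in\Lambda^Ew$, let $\operatorname{par}_{CR}(y)=\iota(y)$ on vertices, and for edges $\operatorname{par}_{CR}(\gamma)=\iota(\gamma)$ if $r(\iota(\gamma))\neq w$, $\operatorname{par}_{CR}(\gamma)=g\,\iota(\gamma)$ if $r(\iota(\gamma))=w$; extend multiplicatively to paths. Set $\mu\sim_{CR}\lambda$ iff $\operatorname{par}_{CR}(\mu)\sim\operatorname{par}_{CR}(\lambda)$; $\Lambda_{CR}$ is the quotient of the path category by $\sim_{CR}$.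
   Formalization: In the definition of complete edge, clause (3) is read as ''g₁μ ~ gη or μg₁ ~ ηg implies g ∈ G''; as printed (''μg₁ ~ gη''), taking g = μ and η = g₁ forces Λ^E w ⊆ wΛ^E, so x = w and H_CR could never hold. *)

(* Defs.v *)
From mathcomp Require Import all_boot all_algebra.
From mathcomp Require Import boolp classical_sets functions cardinality.
From Stdlib Require Import Relation_Operators.

Set Implicit Arguments.
Unset Strict Implicit.
Unset Printing Implicit Defensive.

Import GRing.Theory.
Local Open Scope classical_set_scope.
Local Open Scope ring_scope.

Definition degree (k : nat) := {ffun 'I_k -> nat}.

(* The color e_i is identified with its index i; a set of colors is a subset
   of 'I_k, and the set E of all colors is [set: 'I_k]. *)
Definition color_deg (k : nat) (i : 'I_k) : degree k :=
  [ffun j => (j == i : nat)].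

(* Morphisms form a single type.  The composite [comp f g] (first g, then f)
   is meaningful only if [src f = rng g]; elsewhere its value is irrelevant,
   and no axiom below mentions it. *)
Record degree_cat (k : nat) := DegreeCat {
  ob : Type;
  mor : Type;
  src : mor -> ob;
  rng : mor -> ob;
  idm : ob -> mor;
  comp : mor -> mor -> mor;
  deg : mor -> degree k
}.

Arguments src {k d} _.
Arguments rng {k d} _.

Record is_kgraph (k : nat) (L : degree_cat k) : Prop := IsKGraph {
  kg_src_id : forall x : ob L, src (idm x) = x;
  kg_rng_id : forall x : ob L, rng (idm x) = x;
  kg_src_comp : forall f g : mor L, src f = rng g -> src (comp f g) = src g;
  kg_rng_comp : forall f g : mor L, src f = rng g -> rng (comp f g) = rng f;
  kg_comp_idl : forall f : mor L, comp (idm (rng f)) f = f;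
  kg_comp_idr : forall f : mor L, comp f (idm (src f)) = f;
  kg_comp_assoc : forall f g h : mor L, src f = rng g -> src g = rng h ->
    comp f (comp g h) = comp (comp f g) h;
  kg_deg_id : forall x : ob L, deg (idm x) = 0;
  kg_deg_comp : forall f g : mor L, src f = rng g ->
    deg (comp f g) = deg f + deg g;
  kg_factor : forall (l : mor L) (m n : degree k), deg l = m + n ->
    exists! p : mor L * mor L,
      [/\ src p.1 = rng p.2, deg p.1 = m, deg p.2 = n & comp p.1 p.2 = l];
  kg_countable : countable [set: mor L]
}.

Definition kgraph_isomorphic (k : nat) (L M : degree_cat k) : Prop :=
  exists (Fo : ob L -> ob M) (Fm : mor L -> mor M),
    [/\ bijective Fo, bijective Fm,
        (forall f, src (Fm f) = Fo (src f) /\ rng (Fm f) = Fo (rng f)),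
        (forall x, Fm (idm x) = idm (Fo x)) /\
        (forall f g, src f = rng g -> Fm (comp f g) = comp (Fm f) (Fm g))
      & forall f, deg (Fm f) = deg f].

Section Graphs.
Variable k : nat.

Record cgraph := CGraph {
  vert : Type;
  edg : Type;
  gsrc : edg -> vert;
  grng : edg -> vert;
  gcol : edg -> degree k
}.

(* The path e_1 e_2 ... e_n, composed from right to left, is represented by
   its source v and the list [:: e_1; ...; e_n]; v is the only datum when
   n = 0. *)
Definition seq_rng (G : cgraph) (v : vert G) (es : seq (edg G)) : vert G :=
  if es is e :: _ then grng e else v.

Fixpoint is_path (G : cgraph) (v : vert G) (es : seq (edg G)) : Prop :=
  if es is e :: es' then gsrc e = seq_rng v es' /\ is_path v es' else True.

Definition gpath (G : cgraph) :=
  {p : vert G * seq (edg G) | is_path p.1 p.2}.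

Definition psrc (G : cgraph) (p : gpath G) : vert G := (sval p).1.
Definition pseq (G : cgraph) (p : gpath G) : seq (edg G) := (sval p).2.
Definition prng (G : cgraph) (p : gpath G) : vert G :=
  seq_rng (psrc p) (pseq p).
Definition plen (G : cgraph) (p : gpath G) : nat := size (pseq p).
Definition pdeg (G : cgraph) (p : gpath G) : degree k :=
  \sum_(e <- pseq p) gcol e.

Definition pid (G : cgraph) (v : vert G) : gpath G :=
  exist (fun p => is_path p.1 p.2) (v, [::]) I.

Definition pedge (G : cgraph) (e : edg G) : gpath G :=
  exist (fun p => is_path p.1 p.2) (gsrc e, [:: e]) (conj erefl I).

Lemma seq_rng_cat (G : cgraph) (v : vert G) (es fs : seq (edg G)) :
  seq_rng v (es ++ fs) = seq_rng (seq_rng v fs) es.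
Proof. by case: es. Qed.

Lemma is_path_cat (G : cgraph) (v : vert G) (es fs : seq (edg G)) :
  is_path (seq_rng v fs) es -> is_path v fs -> is_path v (es ++ fs).
Proof.
by elim: es => //= e es IH [-> Hes] Hfs; rewrite seq_rng_cat; split; auto.
Qed.

Lemma pcat_subproof (G : cgraph) (p q : gpath G) :
  psrc p = prng q -> is_path (psrc q) (pseq p ++ pseq q).
Proof.
case: p q => [[v es] /= He] [[u fs] /= Hf]; rewrite /psrc /prng /= => Hv.
by apply: is_path_cat => //; rewrite -[seq_rng _ _]Hv.
Qed.

Definition pcat (G : cgraph) (p q : gpath G) (h : psrc p = prng q) : gpath G :=
  exist (fun p => is_path p.1 p.2) (psrc q, pseq p ++ pseq q) (pcat_subproof h).

Lemma pext_subproof (G H : cgraph) (phi : vert G -> vert H)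
    (psi : edg G -> gpath H)
    (hs : forall e, psrc (psi e) = phi (gsrc e))
    (hr : forall e, prng (psi e) = phi (grng e)) (v : vert G) es :
  is_path v es ->
  seq_rng (phi v) (flatten [seq pseq (psi e) | e <- es]) = phi (seq_rng v es)
  /\ is_path (phi v) (flatten [seq pseq (psi e) | e <- es]).
Proof.
elim: es => [|e es IH] //= [He /IH [Hr Hp]].
rewrite seq_rng_cat Hr -He -hs; split; first by rewrite -hr.
by apply: is_path_cat => //; rewrite Hr -He -hs; exact: (proj2_sig (psi e)).
Qed.

(* multiplicative extension to paths of a map sending edges to paths *)
Definition pext (G H : cgraph) (phi : vert G -> vert H)
    (psi : edg G -> gpath H)
    (hs : forall e, psrc (psi e) = phi (gsrc e))
    (hr : forall e, prng (psi e) = phi (grng e)) (p : gpath G) : gpath H :=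
  exist (fun p => is_path p.1 p.2)
    (phi (psrc p), flatten [seq pseq (psi e) | e <- pseq p])
    (proj2 (pext_subproof hs hr (proj2_sig p))).

Record path_congruence (G : cgraph) (sim : gpath G -> gpath G -> Prop) : Prop :=
  PathCongruence {
  pc_refl : forall p, sim p p;
  pc_sym : forall p q, sim p q -> sim q p;
  pc_trans : forall p q r, sim p q -> sim q r -> sim p r;
  pc_src : forall p q, sim p q -> psrc p = psrc q;
  pc_rng : forall p q, sim p q -> prng p = prng q;
  pc_deg : forall p q, sim p q -> pdeg p = pdeg q;
  pc_cat : forall p p' q q' (h : psrc p = prng q) (h' : psrc p' = prng q'),
    sim p p' -> sim q q' -> sim (pcat h) (pcat h')
}.

Section Quotient.
Variables (G : cgraph) (sim : gpath G -> gpath G -> Prop).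

Definition quot_mor := {C : set (gpath G) | exists p, C = sim p}.

Definition quot_class (p : gpath G) : quot_mor :=
  exist (fun C : set (gpath G) => exists p, C = sim p) (sim p)
    (ex_intro _ p erefl).

Definition quot_repr (C : quot_mor) : gpath G := sval (cid (proj2_sig C)).

(* Operations are computed on representatives; this does not depend on the
   representatives as soon as [path_congruence sim] holds. *)
Definition path_quotient : degree_cat k := {|
  ob := vert G;
  mor := quot_mor;
  src := fun C => psrc (quot_repr C);
  rng := fun C => prng (quot_repr C);
  idm := fun v => quot_class (pid v);
  comp := fun C D =>
    match pselect (psrc (quot_repr C) = prng (quot_repr D)) with
    | left h => quot_class (pcat h)
    | right _ => C
    end;
  deg := fun C => pdeg (quot_repr C)
|}.

Definition kgraph_quotient : Prop :=
  path_congruence sim /\ is_kgraph path_quotient.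

End Quotient.
End Graphs.

Section KGraph.
Variables (k : nat) (L : degree_cat k).
Implicit Types (w x v : ob L) (f g : mor L) (B : set 'I_k).

Definition mor_in B : set (mor L) :=
  [set f | exists2 b, B b & deg f = color_deg b].
Definition edges : set (mor L) := mor_in [set: 'I_k].
Definition mor_into x B : set (mor L) := [set f | mor_in B f /\ rng f = x].
Definition mor_from B x : set (mor L) := [set f | mor_in B f /\ src f = x].

Definition skeleton : cgraph k := {|
  vert := ob L;
  edg := {f : mor L | edges f};
  gsrc := fun e => src (sval e);
  grng := fun e => rng (sval e);
  gcol := fun e => deg (sval e)
|}.

Definition composite (p : gpath skeleton) : mor L :=
  foldr (fun e l => comp (sval e) l) (idm (psrc p)) (pseq p).

Definition path_sim (p q : gpath skeleton) : Prop := composite p = composite q.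

(* [square f g h l] is f g ~ h l, for two-edge paths f g and h l *)
Definition square (f g h l : mor L) : Prop :=
  [/\ src f = rng g, src h = rng l & comp f g = comp h l].

Definition reducible w B : Prop :=
  B !=set0 /\
  exists v,
    [/\ (forall m, mor_into w [set: 'I_k] m -> src m = v -> mor_in B m),
        (forall b, B b -> exists f, mor_into w [set b] = [set f]),
        ~ (rng @` mor_from B w) w
      & src @` mor_into w B = [set v]].

(* the neighborhood of w is taken in the colors outside B *)
Definition nbhd_vert w B : set (ob L) :=
  clos_refl_sym_trans (ob L)
    (fun x y => exists f, [/\ mor_in (~` B) f, src f = x & rng f = y]) w.
Definition nbhd_edge w B : set (mor L) :=
  [set f | [/\ mor_in (~` B) f, nbhd_vert w B (src f)
             & nbhd_vert w B (rng f)]].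

Definition fully_reducible w B : Prop :=
  (forall x, nbhd_vert w B x -> reducible x B) /\
  (\bigcup_(x in nbhd_vert w B) mor_from B x) `&`
  (\bigcup_(x in nbhd_vert w B) mor_into x B) = set0.

Definition stationary (F : set (mor L)) B : Prop :=
  F `<=` edges /\
  forall f1 f2, F f1 -> F f2 ->
    [/\ src f1 = src f2, rng f1 = rng f2,
        (forall l n m, mor_from B (rng f1) l -> edges n -> edges m ->
           square l f1 n m -> F m)
      & (forall l n m, mor_into (src f1) B l -> edges n -> edges m ->
           square f1 l n m -> F n)].

Definition HR w B : Prop :=
  fully_reducible w B /\
  forall x, nbhd_vert w B x -> stationary (mor_into x B) B.

(* In the last two clauses g stands on the same side of its path as g1.  If
   instead g could stand on the other side, then (taking the two paths equal)
   every edge leaving the range of G would belong to G, and [HCR] below could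
   not be satisfied. *)
Definition complete_edge (G : set (mor L)) : Prop :=
  [/\ G `<=` edges,
      (forall i : 'I_k, exists! g, G g /\ deg g = color_deg i),
      (forall g1 g2, G g1 -> G g2 -> src g1 = src g2 /\ rng g1 = rng g2),
      (forall g1 m n g, G g1 -> edges m -> edges n -> edges g ->
         square g1 m g n -> G g)
    & (forall g1 m n g, G g1 -> edges m -> edges n -> edges g ->
         square m g1 n g -> G g)].

Definition HCR w : Prop :=
  [/\ complete_edge (mor_from [set: 'I_k] w),
      complete_edge (mor_into w [set: 'I_k])
    & exists2 x, rng @` mor_from [set: 'I_k] w = [set x] & w <> x].

(* the unique edge of color b with range x, when there is one *)
Definition fedge (b : 'I_k) (x : ob L) : mor L :=
  match pselect (exists f, mor_into x [set b] f) with
  | left h => sval (cid h)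
  | right _ => idm x
  end.

Section Reduction.
Variables (w : ob L) (B : set 'I_k) (hR : HR w B) (b : 'I_k) (hb : B b).

Local Notation U := (nbhd_vert w B).

Lemma fedgeP x : U x -> mor_into x [set b] (fedge b x).
Proof.
move=> Ux; rewrite /fedge; case: pselect => [h|[]]; first by case: (cid h).
have [_ [v [_ + _ _]]] := hR.1.1 x Ux.
by move=> /(_ b hb) [f E]; exists f; rewrite E.
Qed.

Lemma fedge_edge x : U x -> edges (fedge b x).
Proof. by move=> /fedgeP [[c _ E] _]; exists c. Qed.

Lemma fedge_rng x : U x -> rng (fedge b x) = x.
Proof. by move=> /fedgeP []. Qed.

Lemma fedge_src x : U x -> ~ U (src (fedge b x)).
Proof.
move=> Ux Us; have [[c /= -> dc] r_x] := fedgeP Ux.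
suff: (set0 : set (mor L)) (fedge b x) by [].
rewrite -hR.1.2; split.
  by exists (src (fedge b x)) => //; split => //; exists b; rewrite ?dc.
by exists x => //; split => //; exists b; rewrite ?dc.
Qed.

Definition R_edges : set (mor L) :=
  edges `\` (nbhd_edge w B `|` \bigcup_(x in U) mor_into x B).

Lemma R_src_subproof (e : {f : mor L | R_edges f}) :
  ~ U (if pselect (U (src (sval e))) then src (fedge b (src (sval e)))
       else src (sval e)).
Proof. by case: pselect => [h|//]; exact: fedge_src. Qed.

Lemma R_rng_subproof (e : {f : mor L | R_edges f}) : ~ U (rng (sval e)).
Proof.
case: e => f /= [[i _ di] nf] Ur; apply: nf.
have [Bi|nBi] := pselect (B i).
  by right; exists (rng f) => //; split => //; exists i.
left; have fE : mor_in (~` B) f by exists i.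
split=> //; apply: rst_trans Ur _; apply: rst_sym; apply: rst_step.
by exists f.
Qed.

Definition R_graph : cgraph k := {|
  vert := {x : ob L | ~ U x};
  edg := {f : mor L | R_edges f};
  gsrc := fun e => exist (fun x => ~ U x) _ (@R_src_subproof e);
  grng := fun e => exist (fun x => ~ U x) _ (@R_rng_subproof e);
  gcol := fun e => deg (sval e)
|}.

Definition R_incl (e : edg R_graph) : edg skeleton :=
  exist edges (sval e) (proj2_sig e).1.

Definition R_fedge (x : ob L) (Ux : U x) : edg skeleton :=
  exist edges (fedge b x) (fedge_edge Ux).

Definition R_par_edge (e : edg R_graph) : gpath skeleton :=
  match pselect (U (src (sval e))) with
  | left h =>
      pcat (p := pedge (R_incl e)) (q := pedge (R_fedge h))
           (esym (fedge_rng h))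
  | right _ => pedge (R_incl e)
  end.

Lemma R_par_src e : psrc (R_par_edge e) = sval (gsrc e).
Proof. by rewrite /R_par_edge /=; case: pselect. Qed.

Lemma R_par_rng e : prng (R_par_edge e) = sval (grng e).
Proof. by rewrite /R_par_edge /=; case: pselect. Qed.

Definition R_par : gpath R_graph -> gpath skeleton :=
  pext (G := R_graph) (H := skeleton) (phi := sval) R_par_src R_par_rng.

Definition R_sim (p q : gpath R_graph) : Prop :=
  if (2 <= plen p)%N && (2 <= plen q)%N then path_sim (R_par p) (R_par q)
  else p = q.

Definition R_reduction : degree_cat k := path_quotient R_sim.

End Reduction.

Section CompleteEdgeReduction.
Variables (w : ob L) (hCR : HCR w).
Variables (g : mor L) (hg : mor_from [set: 'I_k] w g).

Definition CR_edges : set (mor L) := edges `\` mor_from [set: 'I_k] w.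

Lemma CR_src_subproof (e : {f : mor L | CR_edges f}) : src (sval e) <> w.
Proof. by case: e => f /= [fE nf] sf; apply: nf. Qed.

(* [rng g] is the common range of the edges with source w *)
Lemma CR_rng_subproof (e : {f : mor L | CR_edges f}) :
  (if pselect (rng (sval e) = w) then rng g else rng (sval e)) <> w.
Proof.
case: pselect => [? /=|//]; case: hCR => _ _ [x rx wx] rgw; apply: wx.
have : (rng @` mor_from [set: 'I_k] w) (rng g) by exists g.
by rewrite rx => /= <-.
Qed.

Definition CR_graph : cgraph k := {|
  vert := {x : ob L | x <> w};
  edg := {f : mor L | CR_edges f};
  gsrc := fun e => exist (fun x => x <> w) _ (@CR_src_subproof e);
  grng := fun e => exist (fun x => x <> w) _ (@CR_rng_subproof e);
  gcol := fun e => deg (sval e)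
|}.

Definition CR_incl (e : edg CR_graph) : edg skeleton :=
  exist edges (sval e) (proj2_sig e).1.

Definition CR_par_edge (e : edg CR_graph) : gpath skeleton :=
  match pselect (rng (sval e) = w) with
  | left h =>
      pcat (p := pedge (exist edges g hg.1 : edg skeleton))
           (q := pedge (CR_incl e)) (etrans hg.2 (esym h))
  | right _ => pedge (CR_incl e)
  end.

Lemma CR_par_src e : psrc (CR_par_edge e) = sval (gsrc e).
Proof. by rewrite /CR_par_edge /=; case: pselect. Qed.

Lemma CR_par_rng e : prng (CR_par_edge e) = sval (grng e).
Proof. by rewrite /CR_par_edge /=; case: pselect. Qed.

Definition CR_par : gpath CR_graph -> gpath skeleton :=
  pext (G := CR_graph) (H := skeleton) (phi := sval) CR_par_src CR_par_rng.

Definition CR_sim (p q : gpath CR_graph) : Prop :=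
  path_sim (CR_par p) (CR_par q).

Definition CR_reduction : degree_cat k := path_quotient CR_sim.

End CompleteEdgeReduction.
End KGraph.

Arguments R_graph {k L w B} hR {b} hb.
Arguments R_par {k L w B} hR {b} hb p.
Arguments R_sim {k L w B} hR {b} hb p q.
Arguments R_reduction {k L w B} hR {b} hb.
Arguments CR_graph {k L w} hCR {g} hg.
Arguments CR_par {k L w} hCR {g} hg p.
Arguments CR_sim {k L w} hCR {g} hg p q.
Arguments CR_reduction {k L w} hCR {g} hg.

(* Main.v *)
(* A two-edge path through [w] can only be refactored through [w]:
   g_i f_j = g_j f_i, where f_i enters [w] and g_i leaves it.  Hence both
   reductions are described by the same paths, namely sequences of edges of [L]
   with source different from [w], where an edge [m] into [w] stands for the
   composite [g m] with a chosen edge [g] out of [w]: for CR it is the edge [m]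
   itself, for R it is the edge out of [w] of the same color as [m].  Two
   consecutive edges can be exchanged simultaneously for all choices of [g].
   Exchanges give the existence of factorizations, cancellation in [L] gives
   their uniqueness, and induction on the length then shows that the
   identification of paths does not depend on [g], so that the edges fixed in
   the two reductions are immaterial. *)
Require Import Defs.
From mathcomp Require Import all_boot all_algebra.
From mathcomp Require Import boolp classical_sets functions cardinality.

Set Implicit Arguments.
Unset Strict Implicit.
Unset Printing Implicit Defensive.

Import GRing.Theory.
Local Open Scope classical_set_scope.
Local Open Scope ring_scope.

Local Notation comp := Defs.comp.

(** * Arithmetic of degrees and colors *)

Section Degrees.
Variable k : nat.
Implicit Types d : degree k.

Lemma degreeD d1 d2 i : (d1 + d2) i = (d1 i + d2 i)%N.
Proof. by rewrite ffunE. Qed.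

Lemma degree0 i : (0 : degree k) i = 0%N.
Proof. by rewrite ffunE. Qed.

Lemma degree_addI d d1 d2 : d + d1 = d + d2 -> d1 = d2.
Proof.
by move=> /ffunP e; apply/ffunP => i; move: (e i); rewrite !degreeD => /addnI.
Qed.

Lemma color_degii (i : 'I_k) : color_deg i i = 1%N.
Proof. by rewrite ffunE eqxx. Qed.

Lemma color_degMn_neq (i j : 'I_k) n : i != j -> (color_deg j *+ n) i = 0%N.
Proof.
move=> ij; elim: n => [|n IH]; first by rewrite mulr0n degree0.
by rewrite mulrS degreeD IH ffunE (negPf ij).
Qed.

Lemma sum_color_deg (j : 'I_k) : (\sum_i color_deg j i = 1)%N.
Proof.
rewrite (bigD1 j) //= color_degii big1 // => i ij.
by rewrite ffunE (negPf ij).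
Qed.

Lemma degree_split d i : (0 < d i)%N -> exists d', d = color_deg i + d'.
Proof.
move=> di; exists [ffun j => (d j - (j == i))%N]; apply/ffunP => j.
rewrite degreeD !ffunE subnKC //.
by case: eqP => [->|].
Qed.

End Degrees.

(** * Quotients of path categories and a criterion for being a k-graph *)

Section PathQuotient.
Variables (k : nat) (G : cgraph k) (sim : gpath G -> gpath G -> Prop).
Implicit Types p q : gpath G.

Lemma gpath_eq p q : psrc p = psrc q -> pseq p = pseq q -> p = q.
Proof.
case: p q => [[v es] hp] [[u fs] hq]; rewrite /psrc /pseq /= => e1 e2.
by apply: eq_exist; rewrite e1 e2.
Qed.

Lemma pseq_pcat p q (h : psrc p = prng q) : pseq (pcat h) = pseq p ++ pseq q.
Proof. by []. Qed.

Lemma prng_pcat p q (h : psrc p = prng q) : prng (pcat h) = prng p.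
Proof. by rewrite /prng pseq_pcat seq_rng_cat -[seq_rng _ (pseq q)]h. Qed.

Lemma pdeg_pcat p q (h : psrc p = prng q) : pdeg (pcat h) = pdeg p + pdeg q.
Proof. by rewrite /pdeg /= big_cat. Qed.

Hypothesis simP : path_congruence sim.

Local Notation cls := (quot_class sim).
Local Notation rep := (@quot_repr _ _ sim).

Lemma quot_eq p q : cls p = cls q <-> sim p q.
Proof.
split=> [/(congr1 sval)/= e|pq].
  by have : sim q q := pc_refl simP q; rewrite -e.
apply: eq_exist; rewrite predeqE => r /=.
split; apply: pc_trans simP _ _ _ _ => //; exact: pc_sym.
Qed.

Lemma cls_rep C : cls (rep C) = C.
Proof. by case: C => C hC; apply: eq_exist; rewrite /quot_repr; case: cid. Qed.

Lemma sim_rep p : sim (rep (cls p)) p.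
Proof. by apply/quot_eq; rewrite cls_rep. Qed.

Lemma cls_src p : src (cls p : mor (path_quotient sim)) = psrc p.
Proof. exact: pc_src simP _ _ (sim_rep p). Qed.

Lemma cls_rng p : rng (cls p : mor (path_quotient sim)) = prng p.
Proof. exact: pc_rng simP _ _ (sim_rep p). Qed.

Lemma cls_deg p : deg (cls p : mor (path_quotient sim)) = pdeg p.
Proof. exact: pc_deg simP _ _ (sim_rep p). Qed.

Lemma cls_comp p q (h : psrc p = prng q) :
  comp (cls p : mor (path_quotient sim)) (cls q) = cls (pcat h).
Proof.
rewrite /=; case: pselect => [h'|[]].
  by apply/quot_eq; apply: (pc_cat simP); exact: sim_rep.
by rewrite (pc_src simP (sim_rep p)) (pc_rng simP (sim_rep q)).
Qed.

(** Concatenation of paths gives the category axioms for any path congruence. What remains is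
    countability and the factorization property: one hypothesis supplies factors of prescribed
    degrees up to [sim], the other cancels them. *)
Lemma path_quotient_kgraph :
  countable [set: quot_mor sim] ->
  (forall p m n, pdeg p = m + n -> exists p1 p2 (h : psrc p1 = prng p2),
     [/\ pdeg p1 = m, pdeg p2 = n & sim (pcat h) p]) ->
  (forall p1 p2 q1 q2 (h : psrc p1 = prng p2) (h' : psrc q1 = prng q2),
     pdeg p1 = pdeg q1 -> sim (pcat h) (pcat h') -> sim p1 q1 /\ sim p2 q2) ->
  is_kgraph (path_quotient sim).
Proof.
move=> cG ex un; split=> //.
- by move=> x; rewrite cls_src.
- by move=> x; rewrite cls_rng.
- move=> C D; rewrite -[C]cls_rep -[D]cls_rep cls_src cls_rng => h.
  by rewrite cls_comp !cls_src.
- move=> C D; rewrite -[C]cls_rep -[D]cls_rep cls_src cls_rng => h.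
  by rewrite cls_comp !cls_rng prng_pcat.
- move=> C; rewrite -[C]cls_rep cls_rng [idm _]/(cls (pid _)) cls_comp.
  by congr cls; apply: gpath_eq.
- move=> C; rewrite -[C]cls_rep cls_src [idm _]/(cls (pid _)) cls_comp.
  by congr cls; apply: gpath_eq; rewrite ?pseq_pcat ?cats0.
- move=> C D F; rewrite -[C]cls_rep -[D]cls_rep -[F]cls_rep !cls_src !cls_rng.
  move=> h1 h2; have h3 : psrc (rep C) = prng (pcat h2) by rewrite prng_pcat.
  rewrite (cls_comp h1) (cls_comp h2) (cls_comp h3).
  have h4 : psrc (pcat h1) = prng (rep F) by [].
  by rewrite (cls_comp h4); congr cls; apply: gpath_eq; rewrite ?pseq_pcat ?catA.
- by move=> x; rewrite cls_deg /pdeg big_nil.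
- move=> C D; rewrite -[C]cls_rep -[D]cls_rep cls_src cls_rng => h.
  by rewrite cls_comp !cls_deg pdeg_pcat.
- move=> C m n; rewrite -[C]cls_rep cls_deg => /ex[p1 [p2 [h [d1 d2 e]]]].
  exists (cls p1, cls p2); split.
    have hc : comp (cls p1 : mor (path_quotient sim)) (cls p2) = cls (quot_repr C).
      by rewrite cls_comp; apply/quot_eq.
    by split=> //; [rewrite cls_src cls_rng|rewrite cls_deg|rewrite cls_deg].
  move=> [C1 C2] [hs D1 D2 E].
  have {}hs : psrc (rep C1) = prng (rep C2) by [].
  have {}D1 : pdeg (rep C1) = m by [].
  move: E; rewrite -[C1]cls_rep -[C2]cls_rep -[X in X = _]/(comp _ _).
  rewrite (cls_comp hs) => /quot_eq e'.
  have [||s1 s2] := un _ _ _ _ h hs; first by rewrite d1.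
    by apply: pc_trans e _ => //; exact: pc_sym.
  by congr pair; apply/quot_eq.
Qed.

End PathQuotient.

(** * Isomorphisms of path quotients induced by isomorphisms of colored graphs *)

Section QuotientIso.
Variables (k : nat) (G H : cgraph k).
Variables (simG : gpath G -> gpath G -> Prop).
Variables (simH : gpath H -> gpath H -> Prop).
Hypotheses (GP : path_congruence simG) (HP : path_congruence simH).
Variables (Fo : vert G -> vert H) (Fe : edg G -> edg H).
Hypotheses (Fo_bij : bijective Fo) (Fe_bij : bijective Fe).
Hypotheses (Fsrc : forall e, gsrc (Fe e) = Fo (gsrc e))
  (Frng : forall e, grng (Fe e) = Fo (grng e))
  (Fcol : forall e, gcol (Fe e) = gcol e).

Definition gpath_map (p : gpath G) : gpath H :=
  pext (phi := Fo) (psi := fun e => pedge (Fe e)) Fsrc Frng p.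

Lemma pseq_map p : pseq (gpath_map p) = map Fe (pseq p).
Proof. by rewrite {1}/pseq /=; elim: (pseq p) => //= e es ->. Qed.

Lemma prng_map p : prng (gpath_map p) = Fo (prng p).
Proof. by rewrite /prng pseq_map; case: (pseq p) => [|e es] //=. Qed.

Hypothesis simE : forall p q, simG p q <-> simH (gpath_map p) (gpath_map q).

Lemma quotient_iso :
  kgraph_isomorphic (path_quotient simG) (path_quotient simH).
Proof.
pose Fm (C : mor (path_quotient simG)) : mor (path_quotient simH) :=
  quot_class simH (gpath_map (quot_repr C)).
have FmE p : Fm (quot_class simG p) = quot_class simH (gpath_map p).
  by apply/(quot_eq HP)/simE; exact: sim_rep.
exists Fo, Fm; split=> //.
- have [Go FoK GoK] := Fo_bij; have [Ge FeK GeK] := Fe_bij.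
  have Gs e : psrc (pedge (Ge e)) = Go (gsrc e).
    by rewrite -{2}[e]GeK Fsrc FoK.
  have Gr e : prng (pedge (Ge e)) = Go (grng e).
    by rewrite -{2}[e]GeK Frng FoK.
  (* The inverse bijections act on paths as a right inverse of [gpath_map]. Since [simE] makes the
     induced map on classes injective, this gives a two-sided inverse there. *)
  pose gm (p : gpath H) : gpath G := pext Gs Gr p.
  have gmK p : gpath_map (gm p) = p.
    apply: gpath_eq; first exact: GoK.
    by rewrite pseq_map {1}/pseq /=; elim: (pseq p) => //= e es ->; rewrite GeK.
  exists (fun C => quot_class simG (gm (quot_repr C))) => C.
    rewrite -[RHS]cls_rep //; apply/(quot_eq GP)/simE; rewrite gmK.
    exact: sim_rep.
  by rewrite FmE gmK cls_rep.
- move=> C; rewrite -[C]cls_rep FmE !cls_src // !cls_rng //.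
  by rewrite prng_map.
- split=> [x|C D].
    rewrite [idm x]/(quot_class _ (pid x)) FmE; by congr quot_class; exact: gpath_eq.
  rewrite -[C]cls_rep -[D]cls_rep cls_src // cls_rng // => h.
  rewrite cls_comp // !FmE.
  have h' : psrc (gpath_map (quot_repr C)) = prng (gpath_map (quot_repr D)).
    by rewrite prng_map -h.
  rewrite cls_comp //; congr quot_class; apply: gpath_eq => //.
  by rewrite pseq_pcat !pseq_map pseq_pcat map_cat.
- move=> C; rewrite -[C]cls_rep FmE !cls_deg // /pdeg pseq_map big_map.
  by apply: eq_bigr.
Qed.

End QuotientIso.

(** * Cancellation in a k-graph and the edges entering and leaving [w] *)

Section KGraphFacts.
Variables (k : nat) (L : degree_cat k) (hL : is_kgraph L).
Implicit Types f g h m n : mor L.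

Lemma comp_inj f g f' g' : src f = rng g -> src f' = rng g' ->
  deg f = deg f' -> comp f g = comp f' g' -> f = f' /\ g = g'.
Proof.
move=> fg fg' df e.
have dg : deg g = deg g'.
  apply: (@degree_addI _ (deg f)).
  by rewrite -(kg_deg_comp hL fg) e df (kg_deg_comp hL fg').
have [p [_ U]] := kg_factor hL (kg_deg_comp hL fg).
have /U E1 : [/\ src (f, g).1 = rng (f, g).2, deg (f, g).1 = deg f,
  deg (f, g).2 = deg g & comp (f, g).1 (f, g).2 = comp f g] by [].
have /U : [/\ src (f', g').1 = rng (f', g').2, deg (f', g').1 = deg f,
  deg (f', g').2 = deg g & comp (f', g').1 (f', g').2 = comp f g] by [].
by rewrite E1 => -[-> ->].
Qed.

(** Unique factorization, applied to the degree written as [deg h2 + deg h1]. *)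
Lemma edge_swap h1 h2 : edges h1 -> edges h2 -> src h1 = rng h2 ->
  exists n1 n2, [/\ [/\ edges n1, edges n2, deg n1 = deg h2 & deg n2 = deg h1],
    [/\ src n1 = rng n2, src n2 = src h2 & rng n1 = rng h1]
    & comp h1 h2 = comp n1 n2].
Proof.
move=> [c1 _ d1] [c2 _ d2] e12.
have := kg_deg_comp hL e12; rewrite addrC => /(kg_factor hL)[[n1 n2] [/= + _]].
move=> [e dn1 dn2 ec]; exists n1, n2; split; [split| split |]=> //.
- by exists c2; rewrite ?dn1.
- by exists c1; rewrite ?dn2.
- by rewrite -(kg_src_comp hL e) ec kg_src_comp.
- by rewrite -(kg_rng_comp hL e) ec kg_rng_comp.
Qed.

Variables (w : ob L) (hCR : HCR w).

Local Notation outE := (mor_from [set: 'I_k] w).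
Local Notation inE := (mor_into w [set: 'I_k]).

Lemma out_color i : exists2 g, outE g & deg g = color_deg i.
Proof. by case: hCR => -[_ /(_ i)[g [[? ?] _]] _ _ _] _ _; exists g. Qed.

Lemma in_color i : exists2 f, inE f & deg f = color_deg i.
Proof. by case: hCR => _ [_ /(_ i)[f [[? ?] _]] _ _ _] _; exists f. Qed.

Lemma out_exists m : edges m -> exists2 g, outE g & deg g = deg m.
Proof. by move=> [i _ ->]; exact: out_color. Qed.

Lemma in_exists m : edges m -> exists2 f, inE f & deg f = deg m.
Proof. by move=> [i _ ->]; exact: in_color. Qed.

Lemma out_uniq g g' : outE g -> outE g' -> deg g = deg g' -> g = g'.
Proof.
move=> og og' dgg'; have [[i _ di] _] := og.
case: hCR => -[_ /(_ i)[p [_ U]] _ _ _] _ _.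
by rewrite -(U g) ?(U g') // -dgg'.
Qed.

Lemma in_uniq f f' : inE f -> inE f' -> deg f = deg f' -> f = f'.
Proof.
move=> og og' dgg'; have [[i _ di] _] := og.
case: hCR => _ [_ /(_ i)[p [_ U]] _ _ _] _.
by rewrite -(U f) ?(U f') // -dgg'.
Qed.

Lemma out_rng g g' : outE g -> outE g' -> rng g = rng g'.
Proof.
move=> og og'; case: hCR => -[_ _ + _ _] _ _.
by move=> /(_ g g' og og')[].
Qed.

Lemma in_src f f' : inE f -> inE f' -> src f = src f'.
Proof.
move=> og og'; case: hCR => _ [_ _ + _ _] _.
by move=> /(_ f f' og og')[].
Qed.

Lemma out_rng_neq g : outE g -> rng g <> w.
Proof.
move=> og; case: hCR => _ _ [x e wx] gw; apply: wx.
by have : (rng @` outE) (rng g); [exists g | rewrite e => /= <-].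
Qed.

(** Exchange the colors in [g f]. The closure clause of the complete edge of edges into [w] forces
    the new second factor to enter [w], hence the new first factor leaves [w]; uniqueness in each
    color identifies both. *)
Lemma out_in_comm g f g' f' : outE g -> outE g' -> inE f -> inE f' ->
  deg g = deg f' -> deg g' = deg f -> comp g f = comp g' f'.
Proof.
move=> og og' jf jf' dg dg'.
have e : src g = rng f by rewrite og.2 jf.2.
have [n1 [n2 [[En1 En2 dn1 dn2] [sn1 sn2 rn1] ec]]] := edge_swap og.1 jf.1 e.
have jn2 : inE n2.
  case: hCR => _ [_ _ _ _ inP] _.
  exact: inP jf og.1 En1 En2 (And3 e sn1 ec).
have on1 : outE n1 by split=> //; rewrite sn1 jn2.2.
have -> := out_uniq og' on1 (etrans dg' (esym dn1)).
by have -> := in_uniq jf' jn2 (etrans (esym dg) (esym dn2)).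
Qed.

(** Exchanging colors preserves the source [w], so the new second factor is the edge out of [w] of
    its color. *)
Lemma out_swap g1 g2 h : outE g1 -> outE g2 -> edges h -> deg g2 = deg h ->
  src h = rng g1 -> exists n, [/\ edges n, deg n = deg g1, src n = rng g2,
    rng n = rng h & comp h g1 = comp n g2].
Proof.
move=> o1 o2 eh d2 sh.
have [n1 [n2 [[En1 En2 dn1 dn2] [sn1 sn2 rn1] ec]]] := edge_swap eh o1.1 sh.
have on2 : outE n2 by split=> //; rewrite sn2 o1.2.
have E : n2 = g2 by apply: out_uniq; rewrite // d2.
by exists n1; rewrite -E.
Qed.

(** * Contracted paths: exchanges, cancellation and factorization *)

Variables (g0 : mor L) (hg0 : outE g0).

(* The category [CR_graph hCR hg0] generates, described by the edges of [L]
   with source different from [w]: an edge with range [w] is pushed forward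
   to [rng g0]. *)
Definition crng m : ob L := if pselect (rng m = w) then rng g0 else rng m.

Definition chead y (ms : seq (mor L)) : ob L :=
  if ms is m :: _ then crng m else y.

Fixpoint cpath y (ms : seq (mor L)) : Prop :=
  if ms is m :: ms' then [/\ edges m, src m = chead y ms' & cpath y ms']
  else y <> w.

(** The inserted edge [g] is a parameter, separate from [g0], because the two reductions insert
    different edges out of [w]. Ranges are unaffected, as all these edges have the same range. *)
Definition cpar g m : mor L := if pselect (rng m = w) then comp g m else m.

Fixpoint cval g y (ms : seq (mor L)) : mor L :=
  if ms is m :: ms' then comp (cpar g m) (cval g y ms') else idm y.

Definition cdeg (ms : seq (mor L)) : degree k := \sum_(m <- ms) deg m.

Lemma cdeg_nil : cdeg [::] = 0.
Proof. by rewrite /cdeg big_nil. Qed.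

Lemma cdeg_cons m ms : cdeg (m :: ms) = deg m + cdeg ms.
Proof. by rewrite /cdeg big_cons. Qed.

Lemma sum_cdeg y ms : cpath y ms -> (\sum_i cdeg ms i)%N = size ms.
Proof.
elim: ms => [_|m ms IH /= [[j _ dm] _ /IH <-]].
  by rewrite big1 // => i _; rewrite cdeg_nil degree0.
rewrite -add1n -(sum_color_deg j) -big_split.
by apply: eq_bigr => i _; rewrite cdeg_cons degreeD dm.
Qed.

Lemma crng_neq m : crng m <> w.
Proof. by rewrite /crng; case: pselect => [? /=|//]; exact: out_rng_neq. Qed.

Lemma crng_w m : rng m = w -> crng m = rng g0.
Proof. by rewrite /crng; case: pselect. Qed.

Lemma cparE g m : rng m = w -> cpar g m = comp g m.
Proof. by rewrite /cpar; case: pselect. Qed.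

Lemma cpar_id g m : rng m <> w -> cpar g m = m.
Proof. by rewrite /cpar; case: pselect. Qed.

Lemma crng_id m : rng m <> w -> crng m = rng m.
Proof. by rewrite /crng; case: pselect. Qed.

Lemma chead_neq y ms : cpath y ms -> chead y ms <> w.
Proof. by case: ms => //= m ms _; exact: crng_neq. Qed.

Lemma cpar_src g m : outE g -> src (cpar g m) = src m.
Proof.
move=> og; rewrite /cpar; case: pselect => // rm.
by rewrite kg_src_comp // og.2 rm.
Qed.

Lemma cpar_rng g m : outE g -> rng (cpar g m) = crng m.
Proof.
move=> og; rewrite /cpar /crng; case: pselect => // rm.
by rewrite kg_rng_comp ?og.2 ?rm //; exact: out_rng.
Qed.

Lemma cpath_cval g y ms : outE g -> cpath y ms ->
  src (cval g y ms) = y /\ rng (cval g y ms) = chead y ms.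
Proof.
move=> og; elim: ms => [|m ms IH] /= => [_|[_ sm /IH[s r]]].
  by rewrite kg_src_id ?kg_rng_id.
by rewrite kg_src_comp ?kg_rng_comp ?cpar_src ?cpar_rng // sm r.
Qed.

Lemma cval_src g y ms : outE g -> cpath y ms -> src (cval g y ms) = y.
Proof. by move=> og /(cpath_cval og)[]. Qed.

Lemma cval_rng g y ms : outE g -> cpath y ms -> rng (cval g y ms) = chead y ms.
Proof. by move=> og /(cpath_cval og)[]. Qed.

Lemma cpar_chead g y m ms : outE g -> src m = chead y ms -> cpath y ms ->
  src (cpar g m) = rng (cval g y ms).
Proof. by move=> og sm pm; rewrite cpar_src // cval_rng. Qed.

Lemma chead_cat y ms ns : chead y (ms ++ ns) = chead (chead y ns) ms.
Proof. by case: ms. Qed.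

Lemma cpath_cat y ms ns :
  cpath y (ms ++ ns) <-> cpath (chead y ns) ms /\ cpath y ns.
Proof.
elim: ms => [|m ms IH] /=.
  by split=> [pn|[]//]; split=> //; exact: chead_neq.
rewrite chead_cat; split=> [[em sm /IH[pm pn]]|[[em sm pm] pn]] //.
by split=> //; apply/IH.
Qed.

Lemma cval_cat g y ms ns : outE g -> cpath y (ms ++ ns) ->
  cval g y (ms ++ ns) = comp (cval g (chead y ns) ms) (cval g y ns).
Proof.
move=> og; elim: ms => [|m ms IH] /=.
  by move=> pn; rewrite -(cval_rng og pn) (kg_comp_idl hL).
rewrite chead_cat => -[em sm pmn]; have /cpath_cat[pm pn] := pmn.
rewrite IH // (kg_comp_assoc hL) //; first exact: cpar_chead.
by rewrite cval_src // cval_rng.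
Qed.

(** Every edge into [w] is read as a two-edge path and contributes an extra [deg g]; so the degree
    of the value does not give [cdeg] directly. *)
Lemma cval_deg g y ms : outE g -> cpath y ms ->
  deg (cval g y ms) = cdeg ms + deg g *+ count (fun m => `[< rng m = w >]) ms.
Proof.
move=> og; elim: ms => [_|m ms IH] /=.
  by rewrite mulr0n addr0 cdeg_nil; exact: kg_deg_id.
move=> [em sm pm].
rewrite cdeg_cons (kg_deg_comp hL (cpar_chead og sm pm)) IH //.
case: asboolP => rm; last by rewrite cpar_id // addrA.
rewrite cparE // (kg_deg_comp hL) ?og.2 ?rm // mulrS.
by rewrite -!addrA; rewrite addrCA; congr (_ + _); rewrite addrCA.
Qed.

(* The new pair does not depend on [g]; this is what makes [cval g] and
   [cval g'] identify the same paths. *)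
Lemma cpath_swap m1 m2 : edges m1 -> edges m2 -> src m1 = crng m2 ->
  src m2 <> w -> exists n1 n2,
  [/\ [/\ edges n1, edges n2, deg n1 = deg m2 & deg n2 = deg m1],
      [/\ src n1 = crng n2, src n2 = src m2 & crng n1 = crng m1]
    & forall g, outE g ->
        comp (cpar g m1) (cpar g m2) = comp (cpar g n1) (cpar g n2)].
Proof.
move=> e1 e2 s1 s2; have [rm2|rm2] := pselect (rng m2 = w).
  (* With [gi], [gj] leaving [w] in the colors of [m2], [m1] and [fj], [fa] entering it in the
     colors of [m1], [g], one has [m1 g m2 = m1 gi fa = n gj fa = n g fj]. The pair [n], [fj] is
     chosen before [g]. *)
  move: s1; rewrite crng_w // => s1.
  have [gi ogi dgi] := out_exists e2; have [gj ogj dgj] := out_exists e1.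
  have [fj jfj dfj] := in_exists e1.
  have s1' : src m1 = rng gi by rewrite s1; exact: out_rng.
  have [n [en dn sn rn E]] := out_swap ogi ogj e1 dgj s1'.
  exists n, fj; split; first by split=> //; [exact: jfj.1|rewrite dn].
    split; last by rewrite /crng rn.
    - by rewrite crng_w ?jfj.2 // sn; exact: out_rng.
    - by apply: in_src; [|split].
  move=> g og; have [fa jfa dfa] := in_exists og.1.
  have jm2 : inE m2 by split.
  have main : comp m1 (comp g m2) = comp n (comp g fj).
    rewrite (out_in_comm og ogi jm2 jfa) //.
    rewrite (out_in_comm og ogj jfj jfa) ?dgj ?dfj //.
    by rewrite !(kg_comp_assoc hL) ?E ?ogi.2 ?ogj.2 ?jfa.2.
  rewrite (cparE _ rm2) (cparE _ jfj.2).
  have [rm1|rm1] := pselect (rng m1 = w); last by rewrite !cpar_id ?rn.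
  rewrite !cparE ?rn // -!(kg_comp_assoc hL) ?main ?og.2 ?rm1 ?rn //.
  - by rewrite (kg_rng_comp hL) ?og.2 ?jfj.2 // sn; exact: out_rng.
  - by rewrite (kg_rng_comp hL) ?og.2 ?rm2 // s1; exact: out_rng.
move: s1; rewrite crng_id // => s1.
have [n1 [n2 [[en1 en2 dn1 dn2] [sn1 sn2 rn1] E]]] := edge_swap e1 e2 s1.
(* If [n2] entered [w], then [n1] would leave it and [n1 n2] could be rewritten as [g' f'] with [g']
   of the color of [m1]. Cancellation then makes [m1] an edge out of [w], so [m2] would enter
   [w]. *)
have rn2 : rng n2 <> w.
  move=> rn2; have on1 : outE n1 by split=> //; rewrite sn1.
  have jn2 : inE n2 by split.
  have [g' og' dg'] := out_exists en2; have [f' jf' df'] := in_exists en1.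
  move: E; rewrite (out_in_comm on1 og' jn2 jf') // => E.
  have [m1g _] := comp_inj s1 (etrans og'.2 (esym jf'.2))
    (etrans (esym dn2) (esym dg')) E.
  by apply: rm2; rewrite -s1 m1g og'.2.
exists n1, n2; split=> //; first by split=> //; rewrite /crng ?rn1 //; case: pselect.
move=> g og; rewrite (cpar_id _ rm2) (cpar_id _ rn2).
have [rm1|rm1] := pselect (rng m1 = w); last by rewrite !cpar_id ?rn1.
by rewrite !cparE ?rn1 // -!(kg_comp_assoc hL) ?E ?og.2 ?rm1 ?rn1.
Qed.

(** An edge of color [i] moves to the head of the tail by induction and passes the first edge by
    [cpath_swap]. The result serves all [g] at once, and the bound on [size ns] supports later
    inductions on length. *)
Lemma bring_front y ms i : cpath y ms -> (0 < cdeg ms i)%N ->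
  exists n ns, [/\ cpath y (n :: ns), deg n = color_deg i,
    cdeg (n :: ns) = cdeg ms, size ns < size ms
    & forall g, outE g -> cval g y (n :: ns) = cval g y ms]%N.
Proof.
elim: ms => [|m ms IH] /=; first by rewrite cdeg_nil degree0.
move=> [em sm pm]; have [j _ dm] := em; have [<-|ji] := eqVneq j i.
  by exists m, ms; split.
rewrite cdeg_cons degreeD dm ffunE eq_sym (negPf ji) /= => /(IH pm).
move=> [h [r [/= [eh sh pr] dh dhr sz vhr]]].
have hr_neq := chead_neq pr.
(* The rearranged tail has the same value as the old one, hence the same range; any edge [g] out of
   [w] serves to compare them. *)
have smh : src m = crng h.
  have [g og _] := out_exists em.
  rewrite sm -(cval_rng og pm) -vhr //= kg_rng_comp ?cpar_rng //.
  exact: cpar_chead.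
have [|n1 [n2 [[en1 en2 dn1 dn2] [sn1 sn2 rn1] E]]] := cpath_swap em eh smh.
  by rewrite sh.
exists n1, (n2 :: r); split=> //=.
- by split=> //; split=> //; rewrite sn2.
- by rewrite dn1.
- by rewrite cdeg_cons cdeg_cons -dhr cdeg_cons dn1 dn2 addrCA dm.
- move=> g og; rewrite -vhr //= !(kg_comp_assoc hL) ?E ?cpar_src ?cpar_rng //.
  + by rewrite cval_rng.
  + by rewrite cval_rng // sn2.
Qed.

(** Cancellation in [L] suffices once it is known that the two heads both enter [w] or both do
    not. *)
Lemma cval_cons_inj g y z m n ms ns : outE g ->
  cpath y (m :: ms) -> cpath z (n :: ns) -> deg m = deg n ->
  cval g y (m :: ms) = cval g z (n :: ns) ->
  m = n /\ cval g y ms = cval g z ns.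
Proof.
move=> og /= [em sm pm] [en sn pn] dmn E.
have smr := cpar_chead og sm pm; have snr := cpar_chead og sn pn.
(* If only [m'] enters [w], rewrite [g m'] as [g' f'] with [g'] of the color of [n']. Cancellation
   gives [g' = n'], but [g'] has source [w]. *)
have mixedF m' n' X Y : edges m' -> deg m' = deg n' -> src n' <> w ->
    rng m' = w -> src m' = rng X -> src n' = rng Y ->
    comp (comp g m') X <> comp n' Y.
  move=> em' dmn' sn' rm' sm' snY.
  have [g' og' dg'] := out_exists em'; have [f' jf' df'] := in_exists og.1.
  have jm' : inE m' by split.
  have gf : src g' = rng f' by rewrite og'.2 jf'.2.
  have sf : src f' = rng X by rewrite (in_src jf' jm').
  rewrite (out_in_comm og og' jm' jf') // -(kg_comp_assoc hL gf sf).
  move=> /comp_inj[]; rewrite ?dg' ?(kg_rng_comp hL) //.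
  by move=> g'n; case: sn'; rewrite -g'n og'.2.
have sm' : src m <> w by rewrite sm; exact: chead_neq pm.
have sn' : src n <> w by rewrite sn; exact: chead_neq pn.
move: E smr snr; rewrite !cpar_src //.
have [rm|rm] := pselect (rng m = w); have [rn|rn] := pselect (rng n = w).
- have gm : src g = rng m by rewrite og.2.
  have gn : src g = rng n by rewrite og.2.
  rewrite !cparE // => E smr snr.
  have [] := comp_inj _ _ _ E; rewrite ?(kg_src_comp hL) ?(kg_deg_comp hL) ?dmn //.
  by move=> /comp_inj[].
- by rewrite cparE // cpar_id // => E smr snr; case: (mixedF _ _ _ _ _ _ _ _ _ _ E).
- rewrite (cparE g rn) cpar_id // => /esym E smr snr.
  by case: (mixedF _ _ _ _ _ _ _ _ _ _ E).
- by rewrite !cpar_id // => E smr snr; exact: comp_inj E.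
Qed.

(** By [cval_deg] the degrees agree away from the color of [g], but the numbers of edges into [w]
    might differ. So a color common to both paths is brought to the front and cancelled, by
    induction on the length. *)
Lemma cval_cdeg g y ms ns : outE g -> cpath y ms -> cpath y ns ->
  cval g y ms = cval g y ns -> cdeg ms = cdeg ns.
Proof.
move=> og; have [l] := ubnP (size ms).
elim: l => // l IH in ms ns * => szm pm pn E.
have := congr1 (@deg _ _) E; rewrite !cval_deg //.
set a := count _ _; set b := count _ _ => /ffunP Ed.
have [[c _ dg] _] := og.
suff [[-> ->]|[i [im jn]]] : (ms = [::] /\ ns = [::]) \/
    exists i, (0 < cdeg ms i)%N /\ (0 < cdeg ns i)%N.
- by [].
- have [m [ms' [pm' dm cm sm vm]]] := bring_front pm im.
  have [n [ns' [pn' dn cn sn vn]]] := bring_front pn jn.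
  have [|_ E'] := cval_cons_inj og pm' pn' (etrans dm (esym dn)).
    by rewrite vm ?vn.
  rewrite -cm -cn !cdeg_cons dm dn; congr (_ + _).
  case: pm' pn' => _ _ pm' [_ _ pn'].
  by apply: IH E'; rewrite // -ltnS (leq_trans _ szm).
have cdeg_eq i : i != c -> cdeg ms i = cdeg ns i.
  move=> ic; have := Ed i; rewrite !degreeD dg.
  by rewrite !color_degMn_neq // !addn0.
have head_pos m ms' : cpath y (m :: ms') -> exists i, (0 < cdeg (m :: ms') i)%N.
  by move=> [[i _ dm] _ _]; exists i; rewrite cdeg_cons dm degreeD color_degii.
have cdeg0 i : cdeg [::] i = 0%N by rewrite cdeg_nil degree0.
clear E IH szm; move: pm pn Ed cdeg_eq; rewrite {}/a {}/b.
case: ms => [|m ms]; case: ns => [|n ns] pm pn Ed cdeg_eq; first by left.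
- have [i] := head_pos _ _ pn.
  have := Ed i; rewrite !degreeD cdeg0 [count _ [::]]/= mulr0n degree0 => /esym/eqP.
  by rewrite addn_eq0 => /andP[/eqP-> _].
- have [i] := head_pos _ _ pm.
  have := Ed i; rewrite !degreeD cdeg0 [count _ [::]]/= mulr0n degree0 => /eqP.
  by rewrite addn_eq0 => /andP[/eqP-> _].
(* A color other than [c] has the same multiplicity on both sides; if both heads have color [c],
   then [c] is common. *)
right; have [i im] := head_pos _ _ pm; have [j jn] := head_pos _ _ pn.
have [ic|ic] := eqVneq i c; last by exists i; rewrite -cdeg_eq.
have [jc|jc] := eqVneq j c; last by exists j; rewrite cdeg_eq.
by exists c; rewrite -{1}ic -jc.
Qed.

(** The color of the head of [ms] is brought to the front of [ns] by a rearrangement valid for [g]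
    and [g'] alike; the heads then cancel for [g], and induction treats the tails. *)
Lemma cval_indep g g' y ms ns : outE g -> outE g' -> cpath y ms -> cpath y ns ->
  cval g y ms = cval g y ns -> cval g' y ms = cval g' y ns.
Proof.
move=> og og'; elim: ms ns => [|m ms IH] ns pm pn E.
  have := cval_cdeg og pm pn E.
  case: ns pn E => // n ns [[i _ dn] _ _] _ /ffunP/(_ i).
  by rewrite cdeg_cons dn degreeD color_degii cdeg_nil degree0.
have D := cval_cdeg og pm pn E; have [[i _ dm] _ pm'] := pm.
have [|n [ns' [pn' dn cn sn vn]]] := bring_front (i := i) pn.
  by rewrite -D cdeg_cons dm degreeD color_degii.
have [|-> E'] := cval_cons_inj og pm pn' (etrans dm (esym dn)).
  by rewrite vn ?E.
by rewrite -vn //=; congr comp; apply: IH => //; case: pn'.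
Qed.

(** The colors of [d1] are brought to the front one at a time. This yields existence of
    factorizations. *)
Lemma cval_split g y ms d1 d2 : outE g -> cpath y ms -> cdeg ms = d1 + d2 ->
  exists ms1 ms2, [/\ cpath y (ms1 ++ ms2), cdeg ms1 = d1, cdeg ms2 = d2
    & cval g y (ms1 ++ ms2) = cval g y ms].
Proof.
move=> og; have [l] := ubnP (size ms).
elim: l => // l IH in ms d1 * => szm pm D.
have [[i d1i]|d10] := pselect (exists i, 0 < d1 i)%N; last first.
  have {d10} E : d1 = 0.
    apply/ffunP => i; rewrite degree0; apply/eqP.
    by rewrite -leqn0 leqNgt; apply/negP => ?; apply: d10; exists i.
  by exists [::], ms; split; rewrite ?cdeg_nil ?D ?E ?add0r.
have [|n [ns [pn dn cn sn vn]]] := bring_front (i := i) pm.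
  by rewrite D degreeD ltn_addr.
have [d' Ed'] := degree_split d1i.
have [en sn' pns] := pn.
have szn : (size ns < l)%N by rewrite -ltnS (leq_trans _ szm).
have Dn : cdeg ns = d' + d2.
  apply: (@degree_addI _ (color_deg i)).
  by rewrite -{1}dn -cdeg_cons cn D Ed' addrA.
have [ns1 [ns2 [p12 D1 D2 v12]]] := IH ns d' szn pns Dn.
exists (n :: ns1), ns2; split=> //=.
- split=> //; rewrite sn' -(cval_rng og pns) -v12.
  by rewrite (cval_rng og p12).
- by rewrite cdeg_cons dn D1.
- by rewrite v12 -vn.
Qed.

(** This yields uniqueness of factorizations: the edges of [ms1] are cancelled one by one against
    rearrangements of [ns1]. *)
Lemma cval_cat_inj g y ms1 ms2 ns1 ns2 : outE g ->
  cpath y (ms1 ++ ms2) -> cpath y (ns1 ++ ns2) -> cdeg ms1 = cdeg ns1 ->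
  cval g y (ms1 ++ ms2) = cval g y (ns1 ++ ns2) ->
  cval g (chead y ms2) ms1 = cval g (chead y ns2) ns1 /\
  cval g y ms2 = cval g y ns2.
Proof.
move=> og; elim: ms1 ns1 => [|m ms1 IH] ns1 pm pn D.
  case: ns1 pn D => [|n ns1] pn.
    by move=> _ /= E; rewrite -(cval_rng og pm) -(cval_rng og pn) /= E.
  case: pn => [[i _ dn] _ _] /ffunP/(_ i).
  by rewrite cdeg_cons dn degreeD color_degii cdeg_nil degree0.
have [[i _ dm] _ pm'] := pm; have /cpath_cat[pn1 pn2] := pn.
have [|n [ns [pns dn cn sn vn]]] := bring_front (i := i) pn1.
  by rewrite -D cdeg_cons dm degreeD color_degii.
(* Inside the longer path [ns1] may be replaced by [n :: ns], which has the same value. *)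
rewrite [in RHS]cval_cat // -vn // -cval_cat //; last exact/cpath_cat.
move=> E; have pns2 : cpath y ((n :: ns) ++ ns2) by apply/cpath_cat.
have [mn {}E] := cval_cons_inj og pm pns2 (etrans dm (esym dn)) E.
have [_ _ pns2'] := pns2; have Dns : cdeg ms1 = cdeg ns.
  by apply: (@degree_addI _ (deg m)); rewrite -cdeg_cons D -cn cdeg_cons mn.
have [E1 ->] := IH ns pm' pns2' Dns E.
by rewrite /= mn E1.
Qed.

(** * Colored graphs labelled by contracted paths, and their k-graphs *)

(** The common form of both reductions: [phi] and [beta] identify [G] with the graph whose vertices
    differ from [w] and whose edges are those of [L] not starting at [w], with ranges [crng]. *)
Record contraction (G : cgraph k) (phi : vert G -> ob L)
    (beta : edg G -> mor L) : Prop := Contraction {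
  ct_vert_inj : injective phi;
  ct_vert_neq : forall v, phi v <> w;
  ct_vert_surj : forall y, y <> w -> exists v, phi v = y;
  ct_edge_inj : injective beta;
  ct_edge : forall e, edges (beta e);
  ct_edge_surj : forall m, edges m -> src m <> w -> exists e, beta e = m;
  ct_src : forall e, src (beta e) = phi (gsrc e);
  ct_rng : forall e, crng (beta e) = phi (grng e);
  ct_col : forall e, deg (beta e) = gcol e
}.

Definition pval (G : cgraph k) (phi : vert G -> ob L) (beta : edg G -> mor L)
    (g : mor L) (p : gpath G) : mor L :=
  cval g (phi (psrc p)) (map beta (pseq p)).

Section Contraction.
Variables (G : cgraph k) (phi : vert G -> ob L) (beta : edg G -> mor L).
Hypothesis ctP : contraction phi beta.
Implicit Types p q : gpath G.

Local Notation val := (pval phi beta).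

Lemma ct_chead v es : chead (phi v) (map beta es) = phi (seq_rng v es).
Proof. by case: es => //= e es; exact: ct_rng. Qed.

Lemma ct_cpath v es : is_path v es <-> cpath (phi v) (map beta es).
Proof.
elim: es => [|e es IH] /=; first by split=> // _; exact: ct_vert_neq ctP v.
rewrite ct_chead (ct_src ctP); split=> [[-> /IH pe]|[_ s /IH pe]].
  by split=> //; exact: ct_edge ctP e.
by split=> //; exact: (ct_vert_inj ctP).
Qed.

Lemma gpath_cpath p : cpath (phi (psrc p)) (map beta (pseq p)).
Proof. by apply/ct_cpath; exact: (proj2_sig p). Qed.

Lemma gpath_chead p : chead (phi (psrc p)) (map beta (pseq p)) = phi (prng p).
Proof. exact: ct_chead. Qed.

Lemma pdeg_cdeg p : pdeg p = cdeg (map beta (pseq p)).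
Proof.
by rewrite /pdeg /cdeg big_map; apply: eq_bigr => e _; rewrite (ct_col ctP).
Qed.

Lemma cpath_lift v ms : cpath (phi v) ms ->
  exists2 p : gpath G, psrc p = v & map beta (pseq p) = ms.
Proof.
move=> pm; have [es Ees] : exists es, map beta es = ms.
  elim: ms pm => [|m ms IH] /=; first by exists [::].
  move=> [em sm pm]; have [es <-] := IH pm.
  have [e <-] : exists e, beta e = m.
    by apply: (ct_edge_surj ctP) => //; rewrite sm; exact: chead_neq pm.
  by exists (e :: es).
move: pm; rewrite -{1}Ees => /ct_cpath pe.
by exists (exist (fun t => is_path t.1 t.2) (v, es) pe).
Qed.

Variables (g : mor L) (og : outE g).

Lemma pval_src p : src (val g p) = phi (psrc p).
Proof. by rewrite cval_src //; exact: gpath_cpath. Qed.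

Lemma pval_rng p : rng (val g p) = phi (prng p).
Proof. by rewrite cval_rng ?gpath_chead //; exact: gpath_cpath. Qed.

Lemma pval_psrc p q : val g p = val g q -> psrc p = psrc q.
Proof. by move=> E; apply: (ct_vert_inj ctP); rewrite -!pval_src E. Qed.

Lemma pval_pdeg p q : val g p = val g q -> pdeg p = pdeg q.
Proof.
move=> E; rewrite !pdeg_cdeg; apply: (cval_cdeg og) (gpath_cpath p) _ _.
  by rewrite (pval_psrc E); exact: gpath_cpath.
by rewrite [LHS]E (pval_psrc E).
Qed.

Lemma pval_pcat p q (h : psrc p = prng q) :
  val g (pcat h) = comp (val g p) (val g q).
Proof.
have := gpath_cpath (pcat h).
rewrite /pval pseq_pcat map_cat -[psrc (pcat h)]/(psrc q) => pc.
by rewrite cval_cat // gpath_chead -h.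
Qed.

Lemma pval_indep g' p q : outE g' -> val g p = val g q -> val g' p = val g' q.
Proof.
move=> og' E; have Es := pval_psrc E; move: E (gpath_cpath p).
rewrite /pval Es => E pp; exact: cval_indep og' pp (gpath_cpath q) E.
Qed.

(** Equal values give equal degrees, hence equal lengths, and a single edge is recovered by
    [cval_cons_inj]. *)
Lemma pval_short_inj p q : val g p = val g q -> (plen p < 2)%N -> p = q.
Proof.
move=> E sp; have Es := pval_psrc E; apply: gpath_eq => //.
have := pval_pdeg E; move: E sp (gpath_cpath p) (gpath_cpath q).
rewrite !pdeg_cdeg /pval Es /plen -(size_map beta).
move: {Es} (phi (psrc q)) => y E sp pm pn D.
apply: (inj_map (ct_edge_inj ctP)).
have : size (map beta (pseq q)) = size (map beta (pseq p)).
  by rewrite -(sum_cdeg pm) -(sum_cdeg pn) D.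
move: E sp pm pn D; move: (map beta (pseq p)) (map beta (pseq q)).
move=> [|m [|? ?]] // [|n [|? ?]] // E _ pm pn + _.
rewrite !cdeg_cons cdeg_nil !addr0 => D.
by have [->] := cval_cons_inj og pm pn D E.
Qed.

Variable sim : gpath G -> gpath G -> Prop.
Hypothesis simE : forall p q, sim p q <-> val g p = val g q.

Lemma contraction_congruence : path_congruence sim.
Proof.
split.
- by move=> p; apply/simE.
- by move=> p q /simE e; apply/simE.
- by move=> p q r /simE e /simE e'; apply/simE; rewrite e.
- by move=> p q /simE /pval_psrc.
- by move=> p q /simE E; apply: (ct_vert_inj ctP); rewrite -!pval_rng E.
- by move=> p q /simE /pval_pdeg.
- by move=> p p' q q' h h' /simE E /simE E'; apply/simE; rewrite !pval_pcat E E'.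
Qed.

Lemma contraction_kgraph : kgraph_quotient sim.
Proof.
have simP := contraction_congruence; split=> //.
apply: path_quotient_kgraph => //.
(* Classes embed into the countable set of morphisms of [L] through their values. *)
- have /countable_injP[f /in2TT f_inj] := kg_countable hL.
  apply/countable_injP; exists (fun C => f (val g (quot_repr C))) => C D _ _.
  by move=> /f_inj /simE /(quot_eq simP); rewrite !cls_rep.
- move=> p m n; rewrite pdeg_cdeg => /(cval_split og (gpath_cpath p)).
  move=> [ms1 [ms2 [pm D1 D2 E]]]; have /cpath_cat[pm1 pm2] := pm.
  have [p2 s2 E2] := cpath_lift pm2.
  have hd : chead (phi (psrc p)) ms2 = phi (prng p2) by rewrite -E2 -s2 gpath_chead.
  rewrite hd in pm1; have [p1 s1 E1] := cpath_lift pm1.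
  exists p1, p2, s1; split; rewrite ?pdeg_cdeg ?E1 ?E2 //.
  apply/simE; rewrite -[RHS]E cval_cat // pval_pcat /pval s1 E1 E2 s2 hd //.
- move=> p1 p2 q1 q2 h h' d /simE E.
  have Es : psrc p2 = psrc q2 by exact: (pval_psrc E).
  have := gpath_cpath (pcat h'); have := gpath_cpath (pcat h); move: E d.
  rewrite /pval !pseq_pcat !map_cat !pdeg_cdeg -[psrc (pcat h)]/(psrc p2).
  rewrite -[psrc (pcat h')]/(psrc q2) -Es => E d pp pq.
  have [] := cval_cat_inj og pp pq d E.
  rewrite gpath_chead -h {1}Es gpath_chead -h' => E1 E2.
  by split; apply/simE; rewrite // /pval -Es.
Qed.

End Contraction.

(** Vertices and edges with the same label correspond; [pval_indep] absorbs the difference between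
    [g] and [g']. *)
Lemma contraction_iso (G H : cgraph k) (phi : vert G -> ob L) beta
    (phi' : vert H -> ob L) beta' g g' simG simH :
  contraction phi beta -> contraction phi' beta' -> outE g -> outE g' ->
  (forall p q, simG p q <-> pval phi beta g p = pval phi beta g q) ->
  (forall p q, simH p q <-> pval phi' beta' g' p = pval phi' beta' g' q) ->
  kgraph_isomorphic (path_quotient simG) (path_quotient simH).
Proof.
move=> cG cH og og' sG sH.
have lift_vert (G1 G2 : cgraph k) (f1 : vert G1 -> ob L) b1 (f2 : vert G2 -> ob L) b2 :
    contraction f1 b1 -> contraction f2 b2 -> {F & forall v, f2 (F v) = f1 v}.
  move=> c1 c2; apply: (@choice _ _ (fun v u => f2 u = f1 v)) => v;
  apply: (ct_vert_surj c2).
  exact: ct_vert_neq c1 v.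
have lift_edge (G1 G2 : cgraph k) (f1 : vert G1 -> ob L) b1 (f2 : vert G2 -> ob L) b2 :
    contraction f1 b1 -> contraction f2 b2 -> {F & forall e, b2 (F e) = b1 e}.
  move=> c1 c2; apply: (@choice _ _ (fun e d => b2 d = b1 e)) => e.
  apply: (ct_edge_surj c2); first exact: ct_edge c1 _.
  by rewrite (ct_src c1); exact: ct_vert_neq c1 _.
have [Fo FoE] := lift_vert _ _ _ _ _ _ cG cH.
have [Go GoE] := lift_vert _ _ _ _ _ _ cH cG.
have [Fe FeE] := lift_edge _ _ _ _ _ _ cG cH.
have [Ge GeE] := lift_edge _ _ _ _ _ _ cH cG.
have Fo_bij : bijective Fo.
  exists Go => v; [apply: (ct_vert_inj cG)|apply: (ct_vert_inj cH)].
  - by rewrite GoE FoE.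
  - by rewrite FoE GoE.
have Fe_bij : bijective Fe.
  exists Ge => e; [apply: (ct_edge_inj cG)|apply: (ct_edge_inj cH)].
  - by rewrite GeE FeE.
  - by rewrite FeE GeE.
have Fsrc e : gsrc (Fe e) = Fo (gsrc e).
  by apply: (ct_vert_inj cH); rewrite FoE -(ct_src cH) FeE (ct_src cG).
have Frng e : grng (Fe e) = Fo (grng e).
  by apply: (ct_vert_inj cH); rewrite FoE -(ct_rng cH) FeE (ct_rng cG).
have Fcol e : gcol (Fe e) = gcol e by rewrite -(ct_col cH) FeE (ct_col cG).
have Fval h p : pval phi' beta' h (gpath_map Fsrc Frng p) = pval phi beta h p.
  rewrite /pval pseq_map -map_comp -[psrc _]/(Fo (psrc p)) FoE.
  by congr cval; apply: eq_map => e /=.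
have GP := contraction_congruence cG og sG.
have HP := contraction_congruence cH og' sH.
apply: (quotient_iso GP HP Fo_bij Fe_bij (Fsrc := Fsrc) (Frng := Frng)) => // p q.
split=> [/sG E|/sH]; first by apply/sH; rewrite !Fval; exact: pval_indep E.
by rewrite !Fval => E; apply/sG; exact: pval_indep E.
Qed.

(** * Composites in [L] of paths that extend a map on edges *)

Definition skel_comp (v : ob L) (es : seq (edg (skeleton L))) : mor L :=
  foldr (fun e l => comp (sval e) l) (idm v) es.

Lemma skel_comp_rng (v : vert (skeleton L)) es : is_path v es ->
  src (skel_comp v es) = v /\ rng (skel_comp v es) = seq_rng v es.
Proof.
elim: es => [|e es IH] /= => [_|[he /IH[hs hr]]].
  by rewrite kg_src_id ?kg_rng_id.
by rewrite kg_src_comp ?kg_rng_comp // [src _]he hr.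
Qed.

Lemma skel_comp_cat (v : vert (skeleton L)) es fs :
  is_path (seq_rng v fs) es -> is_path v fs ->
  skel_comp v (es ++ fs) = comp (skel_comp (seq_rng v fs) es) (skel_comp v fs).
Proof.
move=> + pf; have [_ rf] := skel_comp_rng pf; elim: es => [_|e es IH] /=.
  by rewrite -rf (kg_comp_idl hL).
move=> [he pe]; have [se re] := skel_comp_rng pe.
by rewrite IH // (kg_comp_assoc hL) ?re ?se ?rf.
Qed.

(** Reduces the comparison of [R_par] and [CR_par] with [pval] to single edges. *)
Lemma composite_pext (G : cgraph k) (phi : vert G -> ob L)
    (beta : edg G -> mor L) g (psi : edg G -> gpath (skeleton L))
    (hs : forall e, psrc (psi e) = phi (gsrc e))
    (hr : forall e, prng (psi e) = phi (grng e)) (p : gpath G) :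
  (forall e, composite (psi e) = cpar g (beta e)) ->
  composite (pext (H := skeleton L) hs hr p) = pval phi beta g p.
Proof.
move=> psiE; rewrite /composite /pval -[psrc _]/(phi (psrc p)).
rewrite -[pseq (pext _ _ _)]/(flatten [seq pseq (psi e) | e <- pseq p]).
have : is_path (psrc p) (pseq p) := proj2_sig p.
elim: (pseq p) => //= e es IH [he pe].
have [r_es p_es] := pext_subproof hs hr pe.
rewrite -[foldr _ _ _]/(skel_comp _ _) skel_comp_cat //; last first.
  by rewrite r_es -he -hs; exact: (proj2_sig (psi e)).
by rewrite [X in comp _ X]IH // -psiE r_es -he -hs.
Qed.

Lemma composite_pedge (e : edg (skeleton L)) : composite (pedge e) = sval e.
Proof. exact: kg_comp_idr. Qed.

Lemma composite_pedge2 (e f : edg (skeleton L))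
    (h : psrc (pedge e) = prng (pedge f)) :
  composite (pcat h) = comp (sval e) (sval f).
Proof. by congr comp; exact: kg_comp_idr. Qed.

(** * Both reductions as contractions *)

Lemma CR_contraction : contraction (G := CR_graph hCR hg0) sval sval.
Proof.
split=> //.
- by move=> [x hx] [y hy] /= E; exact: eq_exist.
- by move=> [].
- by move=> y hy; exists (exist (fun x => x <> w) y hy).
- by move=> [x hx] [y hy] /= E; exact: eq_exist.
- by move=> [f []].
- move=> m em sm; have hm : CR_edges w m by split=> // -[].
  by exists (exist _ m hm).
Qed.

Lemma CR_simE p q :
  CR_sim hCR hg0 p q <->
  pval (G := CR_graph hCR hg0) sval sval g0 p =
  pval (G := CR_graph hCR hg0) sval sval g0 q.
Proof.
have parE (e : edg (CR_graph hCR hg0)) :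
    composite (CR_par_edge e) = cpar g0 (sval e).
  rewrite /CR_par_edge /cpar; case: pselect => h.
  - by rewrite composite_pedge2.
  - by rewrite composite_pedge.
by rewrite /CR_sim /path_sim /CR_par !(composite_pext _ _ _ parE).
Qed.

(** No color lies outside the full color set, so no edge joins [w] to another vertex of its
    neighborhood. *)
Lemma nbhd_setT x : nbhd_vert w [set: 'I_k] x <-> x = w.
Proof.
split=> [|->]; last exact: Relation_Operators.rst_refl.
suff E a y : Relation_Operators.clos_refl_sym_trans (ob L) (fun x y => exists f,
  [/\ mor_in (~` [set: 'I_k]) f, src f = x & rng f = y]) a y -> a = y.
  by move/E.
elim=> // [u v [f [[c nc _] _ _]]|u v t _ -> _ ->//].
by exfalso; apply: nc.
Qed.

Lemma fedge_in b : inE (fedge b w) /\ deg (fedge b w) = color_deg b.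
Proof.
rewrite /fedge; case: pselect => [h|[]].
  by case: (cid h) => f /= [[c /= -> df] rf]; split=> //; split=> //; exists b.
by have [f jf df] := in_color b; exists f; split; [exists b|exact: jf.2].
Qed.

Section Reduction.
Variables (hR : HR w [set: 'I_k]) (b : 'I_k) (hb : [set: 'I_k] b).

Lemma R_edgesE f : R_edges w [set: 'I_k] f <-> edges f /\ rng f <> w.
Proof.
split=> [[ef nf]|[ef rf]].
  split=> // rf; apply: nf; right; exists w; first exact/nbhd_setT.
  by split.
split=> // -[[[c nc _] _ _]|[x /nbhd_setT -> [_ /rf]]//].
by apply: nc.
Qed.

(** An edge [e] out of [w] is labelled by the edge [f] into [w] of the same color, every other edge
    by itself. By [out_in_comm], [e] followed on the right by [fedge b w] equals [gb f], so R
    inserts [gb]. *)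
Lemma R_contraction gb : outE gb -> deg gb = color_deg b ->
  exists2 beta, contraction (G := R_graph hR hb) sval beta
    & forall e : edg (R_graph hR hb),
        composite (R_par_edge e) = cpar gb (beta e).
Proof.
move=> ogb dgb.
have [beta betaP] : {beta : edg (R_graph hR hb) -> mor L & forall e,
    src (sval e) <> w /\ beta e = sval e \/
    [/\ src (sval e) = w, inE (beta e) & deg (beta e) = deg (sval e)]}.
  apply: (@choice _ _ (fun e m => src (sval e) <> w /\ m = sval e \/
    [/\ src (sval e) = w, inE m & deg m = deg (sval e)])) => e.
  have [se|se] := pselect (src (sval e) = w); last by exists (sval e); left.
  have [f jf df] := in_exists (proj2_sig e).1.
  by exists f; right.
have out_e (e : edg (R_graph hR hb)) : src (sval e) = w -> outE (sval e).
  by move=> se; split=> //; exact: (proj2_sig e).1.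
have rng_e (e : edg (R_graph hR hb)) : rng (sval e) <> w.
  by have /R_edgesE[] := proj2_sig e.
have [jfb dfb] := fedge_in b.
exists beta; [split|].
- by move=> [x hx] [y hy] /= E; exact: eq_exist.
- by move=> [x hx] /= xw; apply: hx; exact/nbhd_setT.
- move=> y hy; have hy' : ~ nbhd_vert w [set: 'I_k] y by move/nbhd_setT.
  by exists (exist _ y hy').
- move=> e e' E; suff : sval e = sval e'.
    by move: e e' {E} => [f hf] [f' hf'] /= ff'; exact: eq_exist.
  have [[se be]|[se jb db]] := betaP e; have [[se' be']|[se' jb' db']] := betaP e'.
  + by rewrite -be E be'.
  + by case: (rng_e e); rewrite -be E; case: jb'.
  + by case: (rng_e e'); rewrite -be' -E; case: jb.
  + by apply: out_uniq; [exact: out_e|exact: out_e|rewrite -db E db'].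
- move=> e; have [[_ ->]|[_ jb _]] := betaP e; last exact: jb.1.
  exact: (proj2_sig e).1.
(* R deletes the edges into [w]; such an [m] is the label of the edge out of [w] of its color. *)
- move=> m em sm; have [rm|rm] := pselect (rng m = w).
    have [g og dg] := out_exists em.
    have hg : R_edges w [set: 'I_k] g.
      by apply/R_edgesE; split; [exact: og.1|exact: out_rng_neq].
    exists (exist _ g hg); have [/= [sg]|/= [_ jb db]] := betaP (exist _ g hg).
      by case: sg; exact: og.2.
    by apply: in_uniq; [|split|rewrite db].
  have hm : R_edges w [set: 'I_k] m by exact/R_edgesE.
  by exists (exist _ m hm); have [[_ ->]|[/= /sm]] := betaP (exist _ m hm).
- move=> e; rewrite /=; case: pselect => [h|ne] /=.
    have /nbhd_setT se := h.
    by have [[]//|[_ jb _]] := betaP e; rewrite se; exact: in_src.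
  have [[_ ->]//|[se _ _]] := betaP e.
  by case: ne; exact/nbhd_setT.
- move=> e; have [[_ ->]|[se jb _]] := betaP e; first by rewrite crng_id.
  by rewrite crng_w ?jb.2 //; apply: out_rng => //; exact: out_e.
- by move=> e; have [[_ ->]|[_ _ ->]] := betaP e.
- move=> e; rewrite /R_par_edge; case: pselect => h.
    have /nbhd_setT se := h; rewrite composite_pedge2 /= se.
    have [[]//|[_ jb db]] := betaP e.
    by rewrite cparE ?jb.2 //; apply: out_in_comm => //; rewrite ?dgb ?dfb //; exact: out_e.
  rewrite composite_pedge /=; have [[_ ->]|[se _ _]] := betaP e.
    by rewrite cpar_id.
  by case: h; exact/nbhd_setT.
Qed.

(** [R_sim] is equality by definition as soon as one path has length at most one; [pval_short_inj]
    shows that equality of values says the same there. *)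
Lemma R_simE gb beta p q : outE gb ->
  contraction (G := R_graph hR hb) sval beta ->
  (forall e : edg (R_graph hR hb),
     composite (R_par_edge e) = cpar gb (beta e)) ->
  R_sim hR hb p q <->
  pval (G := R_graph hR hb) sval beta gb p =
  pval (G := R_graph hR hb) sval beta gb q.
Proof.
move=> ogb ctP parE; rewrite /R_sim; case: ifP => [_|short].
  by rewrite /path_sim /R_par !(composite_pext _ _ _ parE).
split=> [->//|E]; have [sp|lp] := ltnP (plen p) 2.
  exact: pval_short_inj E sp.
apply/esym; apply: (pval_short_inj ctP ogb (esym E)).
by move: short; rewrite lp /= => /negbT; rewrite -leqNgt.
Qed.

Lemma reductions_iso :
  [/\ kgraph_quotient (R_sim hR hb), kgraph_quotient (CR_sim hCR hg0)
    & kgraph_isomorphic (CR_reduction hCR hg0) (R_reduction hR hb)].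
Proof.
have [gb ogb dgb] := out_color b.
have [beta ctR parE] := R_contraction ogb dgb.
have simR p q := R_simE p q ogb ctR parE.
split.
- exact: (contraction_kgraph ctR ogb simR).
- exact: (contraction_kgraph CR_contraction hg0 CR_simE).
- exact: (contraction_iso CR_contraction ctR hg0 ogb CR_simE simR).
Qed.

End Reduction.
End KGraphFacts.

(** * Full reducibility and stationarity from the complete edges at [w] *)

Section CompleteEdge.
Variables (k : nat) (L : degree_cat k) (w : ob L) (hCR : HCR w).

Lemma HCR_fully_reducible : fully_reducible w [set: 'I_k].
Proof.
(* The color set of a reducible vertex is nonempty; a color exists because some edge leaves [w]. *)
have [i0 _] : exists i : 'I_k, True.
  case: hCR => _ _ [x E _]; have : (rng @` mor_from [set: 'I_k] w) x by rewrite E.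
  by move=> [g [[i _ _] _] _]; exists i.
have [f0 jf0 _] := in_color hCR i0.
split=> [x /nbhd_setT ->|].
  split; first by exists i0.
  exists (src f0); split.
  - by move=> m [].
  - move=> b _; have [f jf df] := in_color hCR b; exists f.
    rewrite predeqE => m; split=> [[[_ /= -> dm] rm]|->].
      by apply: in_uniq hCR _ _ _ jf _; [split=> //; exists b|rewrite dm].
    by split; [exists b|exact: jf.2].
  - by move=> [g og]; exact: out_rng_neq hCR _ og.
  - rewrite predeqE => v; split=> [[f jf <-]|->]; last by exists f0.
    exact: in_src hCR _ _ jf jf0.
rewrite predeqE => f; split=> // -[[x /nbhd_setT -> og] [y /nbhd_setT -> jf]].
exact: out_rng_neq hCR _ og jf.2.
Qed.

Lemma HCR_in_edges :
  mor_into w [set: 'I_k] = range (fun b : 'I_k => fedge b w).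
Proof.
rewrite predeqE => f; split=> [jf|[b _ <-]]; last by case: (fedge_in hCR b).
have [[b _ df] _] := jf; have [jb db] := fedge_in hCR b.
by exists b => //; apply: in_uniq hCR _ _ jb jf _; rewrite db.
Qed.

(** The two closure clauses of a complete edge give the two closure conditions of stationarity. *)
Lemma HCR_stationary : stationary (mor_into w [set: 'I_k]) [set: 'I_k].
Proof.
case: (hCR) => _ [ein _ ends sqr sql] _; split=> // f1 f2 j1 j2.
have [s12 r12] := ends _ _ j1 j2; split=> // l n m [el _] en em sq.
- exact: sql j1 el en em sq.
- exact: sqr j1 el em en sq.
Qed.

Lemma HCR_HR : HR w [set: 'I_k].
Proof.
split=> [|x /nbhd_setT ->]; first exact: HCR_fully_reducible.
exact: HCR_stationary.
Qed.

End CompleteEdge.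

Theorem proposition6p3 (k : nat) (L : degree_cat k) (hL : is_kgraph L)
    (w : ob L) (hCR : HCR w) :
  [/\ fully_reducible w [set: 'I_k],
      mor_into w [set: 'I_k] = range (fun b : 'I_k => fedge b w),
      stationary (mor_into w [set: 'I_k]) [set: 'I_k]
    & exists hR : HR w [set: 'I_k],
        forall (b : 'I_k) (hb : [set: 'I_k] b)
               (g : mor L) (hg : mor_from [set: 'I_k] w g),
          [/\ kgraph_quotient (R_sim hR hb),
              kgraph_quotient (CR_sim hCR hg)
            & kgraph_isomorphic (CR_reduction hCR hg) (R_reduction hR hb)]].
Proof.
split; [exact: HCR_fully_reducible|exact: HCR_in_edges|exact: HCR_stationary|].
by exists (HCR_HR hCR) => b hb g hg; exact: reductions_iso.
Qed.
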